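(* Let $A, B \in \mathbb{R}^{n\times n}$ and $b \in \mathbb{R}^n$. The generalized absolute value equation $Ax - B|x| = b$ has no solution $x \in \mathbb{R}^n$ if either of the following conditions holds: (i) $0$ is not an eigenvalue of $A$ and not an eigenvalue of $B$, $0 \neq B^{-1}b \geq 0$, and $\sigma_{\min}(A^{-1}B) > 1$; (ii) $0$ is not an eigenvalue of $B$, $0 \neq B^{-1}b \geq 0$, and $\sigma_{\max}(B^{-1}A) < 1$.
   Context: For a vector $x \in \mathbb{R}^n$, $|x|$ denotes the vector of component-wise absolute values of $x$. Vector inequalities are entrywise; $0 \neq v \geq 0$ means $v \ge 0$ and $v$ is not the zero vector. $\sigma_{\max}$ and $\sigma_{\min}$ denote the maximum and minimum singular values of a matrix. *)

(* Defs.v *)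
From mathcomp Require Import all_boot all_order all_algebra.
From mathcomp Require Import polyrcf.

Set Implicit Arguments.
Unset Strict Implicit.
Unset Printing Implicit Defensive.

Import Order.TTheory GRing.Theory Num.Theory.
Local Open Scope ring_scope.

Definition abs_mx (R : numDomainType) (m n : nat) (A : 'M[R]_(m, n)) :
  'M[R]_(m, n) := map_mx Num.norm A.

(* Square roots of the eigenvalues of M^T M, listed without multiplicity;
   [rootsR] enumerates the roots in R, and the eigenvalues of M^T M all lie
   in R because R is real closed and M^T M is symmetric. *)
Definition singular_values (R : rcfType) (n : nat) (M : 'M[R]_n) :
  seq R := [seq Num.sqrt l | l <- rootsR (char_poly (M^T *m M))].

(* The seeds of the two bigops below matter only for n = 0: otherwise the list
   is nonempty, its entries are nonnegative and [head] is one of them. *)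
Definition sigma_max (R : rcfType) (n : nat) (M : 'M[R]_n) : R :=
  \big[Num.max/0]_(s <- singular_values M) s.

Definition sigma_min (R : rcfType) (n : nat) (M : 'M[R]_n) : R :=
  \big[Num.min/head 0 (singular_values M)]_(s <- singular_values M) s.

Lemma eigenvalue_gram_ge0 (R : rcfType) (n : nat) (M : 'M[R]_n) (l : R) :
  eigenvalue (M^T *m M) l -> 0 <= l.
Proof.
have sq k (w : 'rV[R]_k) : (w *m w^T) 0 0 = \sum_j w 0 j ^+ 2.
  by rewrite mxE; apply: eq_bigr => j _; rewrite mxE -expr2.
have sq_ge0 k (w : 'rV[R]_k) : 0 <= (w *m w^T) 0 0.
  by rewrite sq sumr_ge0 // => j _; rewrite sqr_ge0.
case/eigenvalueP => v vM v0.
have v_gt0 : 0 < (v *m v^T) 0 0.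
  rewrite lt_def sq_ge0 andbT; apply: contraNneq v0 => /eqP.
  rewrite sq psumr_eq0 => [/allP v0|j _]; last exact: sqr_ge0.
  apply/eqP/rowP => j; rewrite mxE; apply/eqP.
  by have := v0 j (mem_index_enum j); rewrite /= sqrf_eq0.
have := sq_ge0 n (v *m M^T); rewrite trmx_mul trmxK mulmxA -(mulmxA v) vM.
by rewrite -scalemxAl mxE pmulr_lge0.
Qed.

Lemma singular_valuesP (R : rcfType) (n : nat) (M : 'M[R]_n) (s : R) :
  (s \in singular_values M) = (0 <= s) && eigenvalue (M^T *m M) (s ^+ 2).
Proof.
have rootsE l : (l \in rootsR (char_poly (M^T *m M))) = eigenvalue (M^T *m M) l.
  have p0 : char_poly (M^T *m M) != 0 by rewrite monic_neq0 ?char_poly_monic.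
  by have := roots_on_rootsR p0 l; rewrite in_itv /= eigenvalue_root_char => <-.
apply/mapP/andP => [[l] | [s0 sM]].
  rewrite rootsE => lM ->; rewrite sqrtr_ge0 sqr_sqrtr ?lM //.
  exact: eigenvalue_gram_ge0 lM.
by exists (s ^+ 2); rewrite ?rootsE // sqrtr_sqr ger0_norm.
Qed.

(* Main.v *)
Require Import Defs.
From mathcomp Require Import all_boot all_order all_algebra.
From mathcomp Require Import sesquilinear spectral complex.
Set Implicit Arguments.
Unset Strict Implicit.

Import Order.TTheory GRing.Theory Num.Theory.
Local Open Scope ring_scope.
Local Open Scope sesquilinear_scope.

(** With [c = B^-1 b] the equation reads [B^-1 A x = |x| + c]. As [c >= 0] and
    [c <> 0], the right-hand side is strictly longer than [x]. So [B^-1 A]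
    stretches [x], which is impossible if its largest singular value is at most
    1; and [A^-1 B] shrinks [|x| + c] to [x], which is impossible if its
    smallest singular value is at least 1. *)

Definition sqnorm (R : pzRingType) (n : nat) (x : 'cV[R]_n) : R :=
  \sum_i x i 0 ^+ 2.

Lemma sqnorm_dot (R : pzRingType) (n : nat) (x : 'cV[R]_n) :
  sqnorm x = (x^T *m x) 0 0.
Proof. by rewrite mxE; apply: eq_bigr => i _; rewrite mxE expr2. Qed.

Lemma sqnorm_ge0 (R : realDomainType) (n : nat) (x : 'cV[R]_n) :
  0 <= sqnorm x.
Proof. by apply: sumr_ge0 => i _; apply: sqr_ge0. Qed.

(* The spectral theorem, obtained from the unitary diagonalization of [S] over
   the algebraic closure [R[i]]; [w i] is the squared modulus of the [i]-th
   coordinate of [x] in an orthonormal eigenbasis. *)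
Lemma symmetric_form_spectral (R : rcfType) (n : nat) (S : 'M[R]_n) :
  S^T = S ->
  exists2 d : 'I_n -> R, (forall i, eigenvalue S (d i)) &
    forall x : 'cV[R]_n, exists w : 'I_n -> R,
      [/\ forall i, 0 <= w i, (x^T *m x) 0 0 = \sum_i w i
        & (x^T *m S *m x) 0 0 = \sum_i d i * w i].
Proof.
move=> symS; pose f := real_complex R.
have fR (a : R) : f a \is Num.real by apply/complex_realP; exists a.
have realM m p (M : 'M[R]_(m, p)) : map_mx f M \is a mxOver Num.real.
  by apply/mxOverP => i j; rewrite mxE.
pose SC := map_mx f S.
have hermS : SC \is hermsymmx.
  apply: realsym_hermsym (realM _ _ _).
  by apply/is_hermitianmxP; rewrite expr0 scale1r map_mx_id // map_trmx symS.
have /orthomx_spectralP := hermitian_normalmx hermS.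
set P := spectralmx SC; set sp := spectral_diag SC => defS.
have uP : P \is unitarymx by apply: spectral_unitarymx.
have unitP := unitarymx_unit uP.
(* In this form each row of [P] is a left eigenvector of [SC], which is what [eigenvalueP] asks
   for. *)
have PS : P *m SC = diag_mx sp *m P by rewrite {1}defS !mulmxA mulmxV ?mul1mx.
have spE i : sp 0 i = f (complex.Re (sp 0 i)).
  rewrite /f RRe_real //.
  exact: (mxOverP (hermitian_spectral_diag_real hermS)).
exists (fun i => complex.Re (sp 0 i)) => [i | x].
  suff: eigenvalue SC (sp 0 i) by rewrite spE eigenvalue_map.
  apply/eigenvalueP; exists (row i P).
    by rewrite -row_mul PS row_mul row_diag_mx -scalemxAl -rowE.
  (* A zero row would make the determinant of [P] vanish, by expansion along that row. *)
  apply: contraTneq unitP => Pi0; rewrite unitmxE (expand_det_row _ i).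
  rewrite big1 ?unitr0 // => j _.
  by move/rowP/(_ j): Pi0; rewrite !mxE => ->; rewrite mul0r.
pose z := P *m map_mx f x.
have zz : z ^t* = (map_mx f x)^T *m P ^t*.
  by rewrite /z trmx_mul map_mxM map_trmx (realmxC (realM _ _ _)).
pose w i := complex.Re (`|z i 0| ^+ 2).
have wE i : f (w i) = `|z i 0| ^+ 2.
  by rewrite /f RRe_real // rpredX // normr_real.
exists w; split=> [i||].
- by rewrite -ler0c -[_%:C%C]/(f _) wE exprn_ge0.
- apply: (@complexI R); rewrite rmorph_sum /= -/f.
  (* Parseval: [P] is unitary, so [P ^t* *m P] cancels, and [x] is real, so conjugation fixes it. *)
  have -> : f ((x^T *m x) 0 0) = (z ^t* *m z) 0 0.
    rewrite zz /z mulmxA -(mulmxA _ _ P) -invmx_unitary // mulVmx // mulmx1.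
    by rewrite map_trmx -map_mxM [RHS]mxE.
  by rewrite mxE; apply: eq_bigr => i _; rewrite wE normCKC !mxE.
- apply: (@complexI R); rewrite rmorph_sum /= -/f.
  have -> : f ((x^T *m S *m x) 0 0) = (z ^t* *m diag_mx sp *m z) 0 0.
    rewrite zz /z -invmx_unitary // mulmxA -!(mulmxA (map_mx f x)^T) -defS.
    by rewrite map_trmx -!map_mxM mulmxA [RHS]mxE.
  rewrite mul_mx_diag mxE; apply: eq_bigr => i _.
  by rewrite /f rmorphM /= -/f -spE wE normCKC !mxE [_ * sp 0 i]mulrC mulrA.
Qed.

(** The squared length of [M *m x] is the quadratic form of the Gram matrix [M^T *m M] at [x], and
    the eigenvalues of that matrix are squares of singular values. *)
Lemma sqnorm_mulmx_spectral (R : rcfType) (n : nat) (M : 'M[R]_n)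
    (x : 'cV[R]_n) :
  exists d w : 'I_n -> R,
    [/\ forall i, d i \in singular_values M, forall i, 0 <= w i,
        sqnorm x = \sum_i w i & sqnorm (M *m x) = \sum_i d i ^+ 2 * w i].
Proof.
have [|d eig_d /(_ x)[w [w_ge0 xx xGx]]] :=
  @symmetric_form_spectral R n (M^T *m M); first by rewrite trmx_mul trmxK.
have d_ge0 i : 0 <= d i by apply: eigenvalue_gram_ge0 (eig_d i).
exists (fun i => Num.sqrt (d i)), w; split=> // [i||].
- by rewrite singular_valuesP sqrtr_ge0 sqr_sqrtr ?eig_d.
- by rewrite sqnorm_dot.
- rewrite sqnorm_dot trmx_mul mulmxA -(mulmxA x^T) xGx.
  by apply: eq_bigr => i _; rewrite sqr_sqrtr.
Qed.

Lemma singular_value_ge0 (R : rcfType) (n : nat) (M : 'M[R]_n) (s : R) :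
  s \in singular_values M -> 0 <= s.
Proof. by rewrite singular_valuesP => /andP[]. Qed.

Lemma sigma_min_ge0 (R : rcfType) (n : nat) (M : 'M[R]_n) : 0 <= sigma_min M.
Proof.
rewrite /sigma_min big_seq; apply: le_bigmin => [|s]; last first.
  exact: singular_value_ge0.
(* What remains is the seed of the minimum: it is [0] or the first singular value. *)
have := @singular_value_ge0 R n M.
by case: (singular_values M) => //= s ss; apply; rewrite mem_head.
Qed.

(** In the spectral expansion the weights are nonnegative and add up to [sqnorm x], so bounding
    every singular value by the largest suffices. The lower bound below is dual. *)
Lemma sqnorm_mulmx_le (R : rcfType) (n : nat) (M : 'M[R]_n) (x : 'cV[R]_n) :
  sqnorm (M *m x) <= sigma_max M ^+ 2 * sqnorm x.
Proof.
have [d [w [dM w_ge0 -> ->]]] := sqnorm_mulmx_spectral M x.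
rewrite mulr_sumr; apply: ler_sum => i _; apply: ler_wpM2r => //.
have d_le : d i <= sigma_max M by apply: le_bigmax_seq.
have d_ge0 := singular_value_ge0 (dM i).
by rewrite lerXn2r // nnegrE // (le_trans d_ge0).
Qed.

Lemma sqnorm_mulmx_ge (R : rcfType) (n : nat) (M : 'M[R]_n) (x : 'cV[R]_n) :
  sigma_min M ^+ 2 * sqnorm x <= sqnorm (M *m x).
Proof.
have [d [w [dM w_ge0 -> ->]]] := sqnorm_mulmx_spectral M x.
rewrite mulr_sumr; apply: ler_sum => i _; apply: ler_wpM2r => //.
have d_ge : sigma_min M <= d i by apply: bigmin_inf_seq (dM i) _ _.
by rewrite lerXn2r // nnegrE ?(le_trans _ d_ge) // sigma_min_ge0.
Qed.

Lemma sqnorm_lt_abs_mxD (R : realDomainType) (n : nat) (x c : 'cV[R]_n) :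
  c != 0 -> (forall i, 0 <= c i 0) -> sqnorm x < sqnorm (abs_mx x + c).
Proof.
move=> c0 c_ge0; have [i ci0] : exists i, c i 0 != 0.
  apply/existsP; apply: contraNT c0; rewrite negb_exists => /forallP c0.
  by apply/eqP/colP => i; rewrite mxE; apply/eqP; rewrite -[_ == _]negbK c0.
have absD j : (abs_mx x + c) j 0 = `|x j 0| + c j 0 by rewrite !mxE.
(* The coordinate with [c i 0 > 0] gives the strict inequality; the others need only a weak one. *)
rewrite /sqnorm (bigD1 i) //= [ltRHS](bigD1 i) //= ltr_leD //.
  rewrite absD -(real_normK (num_real (x i 0))) ltrXn2r ?nnegrE ?addr_ge0 //.
  by rewrite ltrDl lt_def ci0 c_ge0.
apply: ler_sum => j _; rewrite absD -(real_normK (num_real (x j 0))).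
by rewrite lerXn2r ?nnegrE ?addr_ge0 // lerDl.
Qed.

(** The eigenspace at [0] is the kernel. This turns the spectral hypotheses into the invertibility
    that cancelling [invmx] requires. *)
Lemma eigenvalue0 (F : fieldType) (n : nat) (M : 'M[F]_n) :
  eigenvalue M 0 = (M \notin unitmx).
Proof.
by rewrite -row_free_unit -kermx_eq0 /eigenvalue /eigenspace raddf0 subr0.
Qed.

Theorem proposition1 (R : rcfType) (n : nat) (A B : 'M[R]_n) (b : 'cV[R]_n) :
  [/\ ~~ eigenvalue A 0, ~~ eigenvalue B 0,
      invmx B *m b != 0 /\ (forall i, 0 <= (invmx B *m b) i 0)
      & 1 < sigma_min (invmx A *m B)]
  \/
  [/\ ~~ eigenvalue B 0,
      invmx B *m b != 0 /\ (forall i, 0 <= (invmx B *m b) i 0)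
      & sigma_max (invmx B *m A) < 1] ->
  ~ (exists x : 'cV[R]_n, A *m x - B *m abs_mx x = b).
Proof.
move=> AB [x Ax]; pose y := abs_mx x + invmx B *m b.
have {}Ax : B \in unitmx -> A *m x = B *m y.
  by move=> uB; rewrite /y mulmxDr mulKVmx // -Ax addrC subrK.
case: AB => [[] | []]; rewrite ?eigenvalue0 !negbK.
- move=> uA uB [c0 c_ge0] sgt1.
  have Ny : invmx A *m B *m y = x by rewrite -mulmxA -Ax // mulKmx.
  have := sqnorm_mulmx_ge (invmx A *m B) y; rewrite Ny => le_yx.
  (* The contradiction: [sqnorm y <= sqnorm x], since the stretching factor is at least 1. *)
  have := sqnorm_lt_abs_mxD x c0 c_ge0; apply/negP; rewrite -leNgt.
  apply: le_trans le_yx; rewrite ler_peMl ?sqnorm_ge0 //.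
  by rewrite exprn_ege1 // ltW.
- move=> uB [c0 c_ge0] slt1.
  have Mx : invmx B *m A *m x = y by rewrite -mulmxA Ax // mulKmx.
  have := sqnorm_mulmx_le (invmx B *m A) x; rewrite Mx => le_yx.
  have := sqnorm_lt_abs_mxD x c0 c_ge0; apply/negP; rewrite -leNgt.
  apply: le_trans le_yx _; rewrite ler_piMl ?sqnorm_ge0 //.
  (* Squaring keeps [sigma_max] at most 1 because it is nonnegative, being at least its seed [0]. *)
  by rewrite exprn_ile1 ?bigmax_ge_id // ltW.
Qed.
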